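(* Let $n>1$ be an odd integer. Then, modulo $[n]_{q^2}^4\Phi_n(q^2)$, $$ \sum_{k=0}^{(n+1)/2}[4k-1]_{q^2}[4k-1]^2\frac{(q^{-2};q^4)_k^4}{(q^4;q^4)_k^4}q^{4k} \equiv (2q+2q^{-1}-1)[n]_{q^2}^4, $$ and $$ \sum_{k=0}^{n-1}[4k-1]_{q^2}[4k-1]^2\frac{(q^{-2};q^4)_k^4}{(q^4;q^4)_k^4}q^{4k} \equiv (2q+2q^{-1}-1)[n]_{q^2}^4. $$
   Context: $q$ is an indeterminate. For an integer $m$, $[m]=[m]_q=(1-q^m)/(1-q)$ is the $q$-integer, and $[m]_{q^2}=(1-q^{2m})/(1-q^2)$. The $q$-shifted factorial is $(a;q)_0=1$ and $(a;q)_k=(1-a)(1-aq)\cdots(1-aq^{k-1})$ for $k\ge1$. $\Phi_n(q)$ denotes the $n$-th cyclotomic polynomial. Congruences between rational functions in $q$ modulo a polynomial $P(q)$ mean that the difference of the two sides is a rational function whose denominator is coprime to $P(q)$ and whose numerator is divisible by $P(q)$ in $\mathbb{Z}[q]$ (Laurent monomials such as $q^{-1}$ are allowed, being units modulo $P$). *)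

(* Defs.v *)
From HB Require Import structures.
From mathcomp Require Import all_boot all_order all_algebra.
From mathcomp Require Import fraction cyclotomic.
Set Implicit Arguments. Unset Strict Implicit. Unset Printing Implicit Defensive.
Import Order.TTheory GRing.Theory Num.Theory.
Local Open Scope ring_scope.

Definition RF : Type := {fraction {poly rat}}.

Definition qq : RF := tofrac ('X : {poly rat}).

Definition polyZ_to_Q (p : {poly int}) : {poly rat} := map_poly (fun z : int => z%:~R) p.
Definition toRF (p : {poly int}) : RF := tofrac (polyZ_to_Q p).

Definition qint (x : RF) (m : int) : RF := (1 - x ^ m) / (1 - x).

Definition qpoch (a x : RF) (k : nat) : RF := \prod_(i < k) (1 - a * x ^+ i).

Definition congr_mod (F G : RF) (P : {poly int}) : Prop :=
  exists A B : {poly int},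
    [/\ B != 0,
        coprimep (polyZ_to_Q B) (polyZ_to_Q P),
        (exists C : {poly int}, A = P * C)
      & F - G = toRF A / toRF B].

Definition qint_sq_poly (n : nat) : {poly int} := \sum_(i < n) 'X^(2 * i).

Definition modulus (n : nat) : {poly int} :=
  (qint_sq_poly n) ^+ 4 * ('Phi_n \Po 'X^2).

Definition summand (k : nat) : RF :=
  qint (qq ^+ 2) ((4 * k)%:Z - 1) * (qint qq ((4 * k)%:Z - 1)) ^+ 2
  * (qpoch (qq ^- 2) (qq ^+ 4) k) ^+ 4 / (qpoch (qq ^+ 4) (qq ^+ 4) k) ^+ 4
  * qq ^+ (4 * k).

(* Main.v *)
Require Import Defs.
From HB Require Import structures.
From mathcomp Require Import all_boot all_order all_algebra all_field.
From mathcomp Require Import fraction cyclotomic ring zify.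
Set Implicit Arguments. Unset Strict Implicit. Unset Printing Implicit Defensive.
Import Order.TTheory GRing.Theory Num.Theory.
Local Open Scope ring_scope.

(** Put [x = q^2]. The sum is Gosper-summable: the partial sum over [k <= j]
    equals [(x; x^2)_j^4 / (x^2; x^2)_j^4] times an explicit rational function
    of [q] and [X = q^(4(j+1))]. For [j = (n+1)/2] and [j = n-1] the quotient
    [(x; x^2)_j / (x^2; x^2)_j] is [[n]_x] times a fraction [Y / Z], with [Y] a
    central [x]-binomial coefficient or an [x]-Catalan number and [Z] coprime
    to [[n]_x]. This yields the factor [[n]_x^4], and the remaining congruence
    modulo [Phi_n(x)] is checked at the roots of the separable polynomial
    [Phi_n(q^2)], where [x] is a primitive [n]-th root of unity. *)

(** * Finite [x]-products and Gaussian binomials over a commutative ring *)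

Section Products.
Variables (R : comNzRingType) (x : R).

Definition prod_all k : R := \prod_(i < k) (1 - x ^+ i.+1).
Definition prod_odd k : R := \prod_(i < k) (1 - x ^+ (2 * i).+1).
Definition prod_even k : R := \prod_(i < k) (1 - x ^+ (2 * i).+2).
Definition prod_plus k : R := \prod_(i < k) (1 + x ^+ i.+1).

(* [gauss_binom i j] is the [x]-binomial coefficient [i + j] choose [i]. *)
Fixpoint gauss_binom (i j : nat) {struct i} : R :=
  match i with
  | 0 => 1
  | i'.+1 => (fix row j := match j with
      | 0 => 1
      | j'.+1 => gauss_binom i' j'.+1 + x ^+ i * row j'
      end) j
  end.

Lemma gauss_binom0 i : gauss_binom i 0 = 1. Proof. by case: i. Qed.

Lemma gauss_binomSS i j : gauss_binom i.+1 j.+1 =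
  gauss_binom i j.+1 + x ^+ i.+1 * gauss_binom i.+1 j.
Proof. by []. Qed.

Lemma prod_allS k : prod_all k.+1 = prod_all k * (1 - x ^+ k.+1).
Proof. exact: big_ord_recr. Qed.
Lemma prod_oddS k : prod_odd k.+1 = prod_odd k * (1 - x ^+ (2 * k).+1).
Proof. exact: big_ord_recr. Qed.
Lemma prod_evenS k : prod_even k.+1 = prod_even k * (1 - x ^+ (2 * k).+2).
Proof. exact: big_ord_recr. Qed.

(** Double induction on Pascal's rule, the last factor [1 - x^(i+j+2)] being split as
    [(1 - x^(i+1)) + x^(i+1) (1 - x^(j+1))]. *)
Lemma gauss_binom_prod i j :
  prod_all i * prod_all j * gauss_binom i j = prod_all (i + j).
Proof.
elim: i j => [|i IHi] j; first by rewrite /prod_all big_ord0 mul1r mulr1.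
elim: j => [|j IHj].
  by rewrite addn0 gauss_binom0 {2}/prod_all big_ord0 !mulr1.
have -> : prod_all (i.+1 + j.+1) =
    (1 - x ^+ i.+1) * prod_all (i + j.+1) +
    x ^+ i.+1 * (1 - x ^+ j.+1) * prod_all (i.+1 + j).
  have E : x ^+ (i + j).+2 = x ^+ i.+1 * x ^+ j.+1 by rewrite -exprD addSn addnS.
  by rewrite !addSn !addnS prod_allS E; ring.
by rewrite -IHi -IHj gauss_binomSS !prod_allS; ring.
Qed.

Lemma prod_all_double k : prod_all (2 * k) = prod_odd k * prod_even k.
Proof.
elim: k => [|k IHk]; first by rewrite /prod_all /prod_odd /prod_even !big_ord0 mulr1.
by rewrite mulnS !prod_allS IHk prod_oddS prod_evenS; ring.
Qed.

Lemma prod_even_plus k : prod_even k = prod_all k * prod_plus k.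
Proof.
rewrite -big_split; apply: eq_bigr => i _ /=.
by rewrite -[(2 * i).+2]/(2 + 2 * i)%N -mulnS exprM exprAC; ring.
Qed.

(* The common factor is kept because it may vanish when [x] is a root of unity. *)
Lemma prod_odd_gauss k : prod_all k ^+ 2 * prod_plus k * (prod_odd k * prod_plus k ^+ 2)
  = prod_all k ^+ 2 * prod_plus k * (gauss_binom k k * prod_even k).
Proof.
have := prod_all_double k.
rewrite mul2n -addnn -gauss_binom_prod prod_even_plus => E.
have -> : prod_all k ^+ 2 * prod_plus k * (prod_odd k * prod_plus k ^+ 2) = 
  prod_odd k * (prod_all k * prod_plus k) * prod_all k * prod_plus k ^+ 2 by ring.
by rewrite -E; ring.
Qed.

End Products.

(* The [q]-analogue of [n.+2] dividing the central binomial coefficient; the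
   cofactor is a [q]-Catalan number. *)
Lemma gauss_binom_catalan (R : idomainType) (x : R) n :
  (forall k, prod_all x k != 0) ->
  gauss_binom x n.+1 n.+1 = (\sum_(i < n.+2) x ^+ i) *
    (gauss_binom x n.+1 n.+1 - x * gauss_binom x n.+2 n).
Proof.
move=> A0; set b := gauss_binom x n.+1 n.+1; set b' := gauss_binom x n.+2 n.
(* Times [prod_all x n * prod_all x n.+1], both sides become [prod_all x (2n+2)]. *)
have E : (1 - x ^+ n.+1) * b = (1 - x ^+ n.+2) * b'.
  apply: (mulfI (A0 n.+1)); apply: (mulfI (A0 n)).
  have E1 := gauss_binom_prod x n.+1 n.+1; have := gauss_binom_prod x n.+2 n.
  rewrite addSnnS -E1 -/b -/b' !(prod_allS x n.+1) => E2.
  transitivity (prod_all x n.+1 * (prod_all x n * (1 - x ^+ n.+1)) * b); first by ring.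
  by rewrite -prod_allS -E2; ring.
have x1 : 1 - x != 0 by have := A0 1; rewrite /prod_all big_ord1 expr1.
have G : (1 - x) * \sum_(i < n.+2) x ^+ i = 1 - x ^+ n.+2.
  by rewrite -[1 - x]opprB mulNr -subrX1 opprB.
apply: (mulfI x1); rewrite mulrA {}G.
rewrite mulrBr [_ * (x * b')]mulrCA -E [x ^+ n.+2]exprS; ring.
Qed.

(** * Compatibility with ring morphisms *)

Section Morph.
Variables (R S : comNzRingType) (f : {rmorphism R -> S}) (x : R).
Lemma rmorph_gauss_binom i j : f (gauss_binom x i j) = gauss_binom (f x) i j.
Proof.
elim: i j => [|i IHi] j; first by rewrite rmorph1.
elim: j => [|j IHj]; first by rewrite rmorph1.
by rewrite !gauss_binomSS rmorphD rmorphM rmorphXn IHi IHj.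
Qed.
Lemma rmorph_prod_plus k : f (prod_plus x k) = prod_plus (f x) k.
Proof. by rewrite rmorph_prod; apply: eq_bigr => i _; rewrite rmorphD rmorph1 rmorphXn. Qed.
Lemma rmorph_geom k : f (\sum_(i < k) x ^+ i) = \sum_(i < k) f x ^+ i.
Proof. by rewrite rmorph_sum; apply: eq_bigr => i _; rewrite rmorphXn. Qed.
End Morph.

(** * Products and binomials at an [n]-th root of unity, [n] odd *)

Section RootOfUnity.
Variables (F : fieldType) (n : nat) (u : F).
Hypothesis n_odd : odd n.

Section NonTrivial.
Hypothesis un1 : u ^+ n = 1.
Hypothesis u_neq1 : u != 1.
Hypothesis two_neq0 : (2 : F) != 0.

Lemma geom_root_of_unity : \sum_(i < n) u ^+ i = 0.
Proof.
apply/eqP; have := subrX1 u n; rewrite un1 subrr => /esym/eqP.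
by rewrite mulf_eq0 subr_eq0 (negPf u_neq1).
Qed.

Lemma geom_root_of_unityS : \sum_(i < n.+1) u ^+ i = 1.
Proof. by rewrite big_ord_recr /= geom_root_of_unity add0r un1. Qed.

(** If [u^k = -1], raising to the odd power [n] gives [1 = -1]. *)
Lemma root_of_unity_add1_neq0 k : 1 + u ^+ k != 0.
Proof.
apply/eqP => /(canRL (addKr _)); rewrite addr0 => E.
have := congr1 (fun v => v ^+ n) E; rewrite exprAC un1 expr1n -signr_odd n_odd expr1.
by move/eqP; rewrite -subr_eq0 opprK (_ : 1 + 1 = 2) // (negPf two_neq0).
Qed.

Lemma prod_plus_neq0 k : prod_plus u k != 0.
Proof. by apply/prodf_neq0 => i _; apply: root_of_unity_add1_neq0. Qed.

End NonTrivial.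

Section Primitive.
Hypothesis u_prim : n.-primitive_root u.
Let un1 : u ^+ n = 1 := prim_expr_order u_prim.

Lemma prim_sub_neq0 i : (0 < i < n)%N -> 1 - u ^+ i != 0.
Proof.
case/andP=> i0 ltin; rewrite subr_eq0 eq_sym -(prim_order_dvd u_prim).
by apply/negP => /(dvdn_leq i0); rewrite leqNgt ltin.
Qed.

Lemma prod_all_neq0 k : (k < n)%N -> prod_all u k != 0.
Proof.
move=> ltkn; apply/prodf_neq0 => i _; apply: prim_sub_neq0.
by rewrite /= (leq_ltn_trans (ltn_ord i)).
Qed.

Lemma prod_all_eq0 k : (n <= k)%N -> prod_all u k = 0.
Proof.
move=> lenk; have n0 := prim_order_gt0 u_prim.
have lt : (n.-1 < k)%N by rewrite prednK.
by rewrite /prod_all (bigD1 (Ordinal lt)) //= prednK // un1 subrr mul0r.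
Qed.

(** The factor [1 - u^n = 0] occurs in [prod_all u (i + j)], whereas [prod_all u i] and
    [prod_all u j] are nonzero. *)
Lemma gauss_binom_eq0 i j : (i < n)%N -> (j < n)%N -> (n <= i + j)%N ->
  gauss_binom u i j = 0.
Proof.
move=> ltin ltjn le; have := gauss_binom_prod u i j.
rewrite (prod_all_eq0 le) => /eqP; rewrite !mulf_eq0.
by rewrite !(negPf (prod_all_neq0 _)) //= => /eqP.
Qed.

(** In Pascal's rule with [u^n = 1] the other term vanishes by [gauss_binom_eq0], so the value does
    not change with [j]. *)
Lemma gauss_binom_order j : (j < n)%N -> gauss_binom u n j = 1.
Proof.
have n0 := prim_order_gt0 u_prim.
elim: j => [|j IHj] ltjn; first exact: gauss_binom0.
rewrite -[X in gauss_binom u X](prednK n0) gauss_binomSS prednK // un1 mul1r.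
rewrite IHj ?(ltnW ltjn) // gauss_binom_eq0 ?add0r //; first by rewrite prednK.
by rewrite addnS -addSn prednK // leq_addr.
Qed.

(** Doubling permutes the nonzero residues modulo the odd [n]: the first half of the exponents are
    the even residues, and the second half reduce to the odd ones. *)
Lemma prod_even_order : prod_even u n.-1 = prod_all u n.-1.
Proof.
have En : n = (n./2).*2.+1 by rewrite -[LHS]odd_double_half n_odd.
set m := n./2 in En.
have -> : n.-1 = (m + m)%N by rewrite En -addnn.
rewrite {1}/prod_even big_split_ord /= addnn -mul2n prod_all_double mulrC.
congr (_ * _); apply: eq_bigr => i _ /=.
have -> : (2 * (m + i)).+2 = (n + (2 * i).+1)%N by lia.
by rewrite exprD un1 mul1r.
Qed.

Lemma prod_plus_order : prod_plus u n.-1 = 1.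
Proof.
have := prod_even_plus u n.-1; rewrite prod_even_order.
have n0 := prim_order_gt0 u_prim.
by rewrite -[LHS]mulr1 => /mulfI -> //; apply: prod_all_neq0; rewrite prednK.
Qed.

(** Reversing the product pairs [1 - u^(n-2i-2)] with [u^(2i+2)]; as [u^n = 1], their product is
    [-(1 - u^(2i+2))]. *)
Lemma prod_odd_reflect :
  prod_odd u n./2 * u ^+ (n./2 * (n./2).+1) = (-1) ^+ n./2 * prod_even u n./2.
Proof.
have En : n = (n./2).*2.+1 by rewrite -[LHS]odd_double_half n_odd.
set m := n./2 in En *.
have -> : u ^+ (m * m.+1) = \prod_(i < m) u ^+ (2 * i).+2.
  rewrite prodrXr; congr (_ ^+ _); elim: {En}m => [|k IHk]; first by rewrite big_ord0.
  by rewrite big_ord_recr /= -IHk; lia.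
have -> : (-1) ^+ m = \prod_(i < m) (-1) :> F by rewrite prodr_const card_ord.
rewrite /prod_odd (reindex_inj rev_ord_inj) -!big_split; apply: eq_bigr => i _ /=.
have lti := ltn_ord i.
rewrite mulrBl mul1r -exprD.
have -> : ((2 * (m - i.+1)).+1 + (2 * i).+2)%N = n by lia.
by rewrite un1; ring.
Qed.

(** With [m = n./2], [prod_odd_reflect] and [prod_odd_gauss] give the binomial up to a sign and a
    power of [u]. The fourth power removes the sign, and [4m(m+1) + 1 = n^2] leaves exactly one
    factor [u]. *)
Lemma gauss_binom_half_pow4 :
  gauss_binom u n./2 n./2 ^+ 4 = u * (prod_plus u n./2 ^+ 2) ^+ 4.
Proof.
have En : n = (n./2).*2.+1 by rewrite -[LHS]odd_double_half n_odd.
have Hr := prod_odd_reflect; have Hg := prod_odd_gauss u n./2.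
have Hp := prod_even_plus u n./2; have Hd := prod_all_double u n./2.
set m := n./2 in En Hr Hg Hp Hd *.
have A0 : prod_all u m != 0 by apply: prod_all_neq0; lia.
have : prod_all u (2 * m) != 0 by apply: prod_all_neq0; lia.
rewrite Hd mulf_eq0 negb_or => /andP[O0 E0].
have P0 : prod_plus u m != 0 by apply: contra_neq E0 => P0; rewrite Hp P0 mulr0.
move/(mulfI (mulf_neq0 (expf_neq0 2 A0) P0)): Hg => Hg.
have := congr1 (fun v => v ^+ 4) Hg; rewrite !exprMn => {}Hg.
have := congr1 (fun v => v ^+ 4) Hr; rewrite !exprMn [(_ ^+ m) ^+ 4]exprAC.
rewrite (_ : (-1) ^+ 4 = 1 :> F); last by ring.
rewrite expr1n mul1r -exprM => {}Hr.
apply: (mulIf (expf_neq0 4 E0)); rewrite -Hg -Hr.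
set P := prod_plus u m ^+ 4 * _; set Q := prod_odd u m ^+ 4.
have -> : u * P * (Q * u ^+ (m * m.+1 * 4)) = Q * P * u ^+ (m * m.+1 * 4).+1.
  by rewrite exprS; ring.
have -> : ((m * m.+1 * 4).+1 = n * n)%N by rewrite {}En; nia.
by rewrite exprM un1 expr1n mulr1.
Qed.

End Primitive.
End RootOfUnity.

(* With [X = q ^+ (4 * k)], the summand is, up to a factor depending only
   on [q], the difference in [k] of
   [((x^-1; x^2)_k / (x^2; x^2)_(k-1)) ^+ 4] times a quadratic polynomial in
   [X], where [x = q ^+ 2]; Gosper's algorithm produces this polynomial. *)
Definition certificate (R : comNzRingType) (q X : R) : R :=
  2 * (q ^+ 6 * (1 + q ^+ 2) - 4 * q ^+ 4 * X + (1 + q ^+ 2) * X ^+ 2)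
  - q * (1 - q ^+ 2) ^+ 2 * X * (1 + q) ^+ 2.

Definition certificate_den (R : comNzRingType) (q : R) : R :=
  q ^+ 9 * (1 + q ^+ 2) * (1 - q ^+ 2) ^+ 2.

(** * Nonvanishing in [RF] and the shape of the summand *)

Lemma qqX_eq_tofrac p k : (qq ^+ k == tofrac p) = ('X^k == p).
Proof. by rewrite /qq -tofracXn tofrac_eq. Qed.

Lemma qq_neq0 : qq != 0.
Proof. by rewrite tofrac_eq0 polyX_eq0. Qed.

Lemma one_sub_qqX k : (0 < k)%N -> 1 - qq ^+ k != 0.
Proof.
move=> k0; rewrite subr_eq0 eq_sym -tofrac1 qqX_eq_tofrac -subr_eq0.
by rewrite -size_poly_eq0 size_XnsubC.
Qed.

Lemma one_add_qqX k : (0 < k)%N -> 1 + qq ^+ k != 0.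
Proof.
move=> k0; rewrite addrC -[1]opprK subr_eq0 -tofrac1 -tofracN qqX_eq_tofrac -subr_eq0.
by rewrite -polyCN -size_poly_eq0 size_XnsubC.
Qed.

Lemma prod_all_qq_neq0 k : prod_all (qq ^+ 2) k != 0.
Proof. by apply/prodf_neq0 => i _; rewrite -exprM one_sub_qqX. Qed.

Lemma prod_plus_qq_neq0 k : prod_plus (qq ^+ 2) k != 0.
Proof. by apply/prodf_neq0 => i _; rewrite -exprM one_add_qqX. Qed.

Lemma prod_even_qq_neq0 k : prod_even (qq ^+ 2) k != 0.
Proof. by rewrite prod_even_plus mulf_neq0 ?prod_all_qq_neq0 ?prod_plus_qq_neq0. Qed.

Lemma qpoch_even k : qpoch (qq ^+ 4) (qq ^+ 4) k = prod_even (qq ^+ 2) k.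
Proof. by apply: eq_bigr => i _; rewrite -exprS -!exprM; congr (1 - _ ^+ _); lia. Qed.

(** The factor of index 0 carries the negative exponent and is set apart; in the others
    [q^-2 q^(4(i+1)) = x^(2i+1)] with [x = q^2]. *)
Lemma qpoch_odd k :
  qpoch (qq ^- 2) (qq ^+ 4) k.+1 = (1 - qq ^- 2) * prod_odd (qq ^+ 2) k.
Proof.
rewrite /qpoch big_ord_recl expr0 mulr1; congr (_ * _).
apply: eq_bigr => i _; congr (1 - _); rewrite /= -!exprM.
apply: (mulfI (expf_neq0 2 qq_neq0)); rewrite mulVKf ?expf_neq0 ?qq_neq0 //.
by rewrite -exprD; congr (_ ^+ _); rewrite /bump /=; lia.
Qed.

(** The last factor [1 - X] of the denominator product is displayed apart, to match one telescoping
    step. *)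
Lemma summandS k (q := qq) (X := qq ^+ (4 * k.+1)) :
  summand k.+1 =
  ((1 - X ^+ 2 / q ^+ 2) / (1 - q ^+ 2)) * ((1 - X / q) / (1 - q)) ^+ 2
  * ((1 - q ^- 2) * prod_odd (q ^+ 2) k) ^+ 4 / 
    (prod_even (q ^+ 2) k * (1 - X)) ^+ 4 * X.
Proof.
rewrite /summand qpoch_odd qpoch_even prod_evenS -/X /qint.
have E : forall x : RF, x != 0 -> x ^ ((4 * k.+1)%:Z - 1) = x ^+ (4 * k.+1) / x.
  by move=> x x0; rewrite expfzDr // exprN1.
rewrite !E ?expf_neq0 ?qq_neq0 // -/q -/X.
have -> : (q ^+ 2) ^+ (4 * k.+1) = X ^+ 2 by rewrite exprAC.
by have -> : (q ^+ 2) ^+ (2 * k).+2 = X by rewrite -exprM; congr (_ ^+ _); lia.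
Qed.

(** * Telescoping of the sum *)

Section Telescoping.
Variables (F : fieldType) (q : F).
Hypotheses (q0 : q != 0) (q1 : 1 - q != 0) (q2 : 1 - q ^+ 2 != 0)
  (q3 : 1 + q ^+ 2 != 0).

(** Base case of the telescoping: the term at [k = 0], where the [q]-integers are [[-1]]. *)
Lemma certificate_start :
  (1 - q ^- 2) / (1 - q ^+ 2) * ((1 - q^-1) / (1 - q)) ^+ 2
  = certificate q (q ^+ 4) / certificate_den q.
Proof.
rewrite /certificate /certificate_den; field.
by rewrite q0 q1 q2 q3.
Qed.

(** Gosper's equation for the certificate, freed of the products [O] and [E] that [telescope_step]
    restores. *)
Lemma certificate_step X : 1 - X != 0 ->
  certificate q (q ^+ 4 * X) * (1 - X / q ^+ 2) ^+ 4 =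
  (1 - X) ^+ 4 * certificate q X + (1 - X ^+ 2 / q ^+ 2) / (1 - q ^+ 2)
    * ((1 - X / q) / (1 - q)) ^+ 2 * (1 - q ^- 2) ^+ 4 * X * certificate_den q.
Proof.
move=> X1; rewrite /certificate /certificate_den; field.
by rewrite q0 q1 q2.
Qed.

Lemma telescope_step (O E X : F) : E != 0 -> 1 - X != 0 ->
  (O / E) ^+ 4 * certificate q X / certificate_den q
  + (1 - X ^+ 2 / q ^+ 2) / (1 - q ^+ 2) * ((1 - X / q) / (1 - q)) ^+ 2
    * ((1 - q ^- 2) * O) ^+ 4 / (E * (1 - X)) ^+ 4 * X
  = (O * (1 - X / q ^+ 2) / (E * (1 - X))) ^+ 4
    * certificate q (q ^+ 4 * X) / certificate_den q.
Proof.
move=> E0 X1; have d0 : certificate_den q != 0 by rewrite !mulf_neq0 ?expf_neq0.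
have := certificate_step X1.
(* The certificate becomes opaque, tied down only by [certificate_step], so that [field] faces small
   terms. *)
move: (certificate q X) (certificate q _) (certificate_den q) d0 => c c' d d0.
set s := (1 - X ^+ 2 / _) / _ * _ => Hstep.
rewrite [LHS](_ : _ = (O / (E * (1 - X))) ^+ 4 / d *
  ((1 - X) ^+ 4 * c + s * (1 - q ^- 2) ^+ 4 * X * d)).
  rewrite -Hstep; move: (1 - X) X1 => Y X1; field.
  by rewrite ?q0 ?d0 ?E0 ?X1.
move: (1 - X) X1 => Y X1; move: s {Hstep} => s; field.
by rewrite ?q0 ?d0 ?E0 ?X1.
Qed.
End Telescoping.

Lemma sum_summand j :
  \sum_(0 <= k < j.+1) summand k =
  (prod_odd (qq ^+ 2) j / prod_even (qq ^+ 2) j) ^+ 4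
  * certificate qq (qq ^+ (4 * j.+1)) / certificate_den qq.
Proof.
have q0 := qq_neq0; have := one_sub_qqX (isT : 0 < 1)%N; rewrite expr1 => q1.
have q2 := one_sub_qqX (isT : 0 < 2)%N; have q3 := one_add_qqX (isT : 0 < 2)%N.
elim: j => [|j IHj].
  rewrite big_nat1 /summand /qint /qpoch /prod_odd /prod_even !big_ord0.
  rewrite muln0 sub0r muln1 !exprN1 divr1 !expr1n divr1 expr0 !mulr1 mul1r.
  exact: (certificate_start q0 q1 q2 q3).
rewrite big_nat_recr //= IHj summandS prod_oddS prod_evenS.
(* With [X = qq^(4(j+1))], the factors gained by the two products are [1 - X / qq^2] and [1 - X], as
   [telescope_step] expects. *)
have -> : qq ^+ (4 * j.+2) = qq ^+ 4 * qq ^+ (4 * j.+1).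
  by rewrite -exprD; congr (_ ^+ _); lia.
have -> : (qq ^+ 2) ^+ (2 * j).+2 = qq ^+ (4 * j.+1).
  by rewrite -exprM; congr (_ ^+ _); lia.
have -> : (qq ^+ 2) ^+ (2 * j).+1 = qq ^+ (4 * j.+1) / qq ^+ 2.
  apply: (canRL (mulfK (expf_neq0 2 q0))).
  by rewrite -exprM -exprD; congr (_ ^+ _); lia.
apply: (telescope_step q0 q1 q2 q3); first exact: prod_even_qq_neq0.
exact: one_sub_qqX.
Qed.

(** * Testing coprimality and divisibility by evaluation at algebraic numbers *)

Definition eval_at (w : algC) : {rmorphism {poly rat} -> algC} :=
  horner_eval w \o map_poly (ratr : rat -> algC).

Lemma eval_atE w p : eval_at w p = (map_poly ratr p).[w].
Proof. by []. Qed.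

Lemma eval_atX w : eval_at w 'X = w.
Proof. by rewrite eval_atE map_polyX hornerX. Qed.

Lemma map_ratr_polyZ (p : {poly int}) :
  map_poly ratr (polyZ_to_Q p) = map_poly intr p :> {poly algC}.
Proof.
by rewrite -map_poly_comp; apply: eq_map_poly => z /=; rewrite ratr_int.
Qed.

Lemma qint_sq_polyQ n :
  polyZ_to_Q (qint_sq_poly n) = \sum_(i < n) ('X ^+ 2) ^+ i.
Proof.
rewrite /polyZ_to_Q rmorph_sum; apply: eq_bigr => i _ /=.
by rewrite map_polyXn exprM.
Qed.

Lemma root_cyclotomic_sq n w : (0 < n)%N ->
  root (map_poly intr ('Phi_n \Po 'X^2) : {poly algC}) w = n.-primitive_root (w ^+ 2).
Proof.
move=> n0; have [z zP] := C_prim_root_exists n0.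
rewrite -(root_cyclotomic zP) -(Cintr_Cyclotomic zP) !rootE.
by rewrite map_comp_poly map_polyXn horner_comp hornerXn.
Qed.

(** A vanishing geometric sum in [w^2] forces [w^(2n) = 1], and at [w^2 = 1] that sum would be [n].
    At a root of the cyclotomic factor, [w^2] is primitive. *)
Lemma root_modulus n w : (1 < n)%N ->
  root (map_poly ratr (polyZ_to_Q (modulus n)) : {poly algC}) w ->
  (w ^+ 2) ^+ n = 1 /\ w ^+ 2 != 1.
Proof.
move=> n1 wP; have n0 := ltnW n1.
suff: root (map_poly ratr (polyZ_to_Q (qint_sq_poly n)) : {poly algC}) w
      \/ n.-primitive_root (w ^+ 2).
  case=> [|uP].
    rewrite rootE qint_sq_polyQ -eval_atE rmorph_geom rmorphXn eval_atX => /eqP S0.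
    have := subrX1 (w ^+ 2) n; rewrite S0 mulr0 => /eqP; rewrite subr_eq0 => /eqP Un.
    split=> //; apply: contra_eq_neq S0 => ->.
    under eq_bigr do rewrite expr1n.
    by rewrite sumr_const card_ord pnatr_eq0 -lt0n.
  split; first exact: prim_expr_order.
  by rewrite -[X in X != 1]expr1 -(prim_order_dvd uP) gtnNdvd.
move: wP; rewrite map_ratr_polyZ /modulus rmorphM rmorphXn /= rootM.
case/orP=> [|]; last by rewrite root_cyclotomic_sq; first by right.
by rewrite -map_ratr_polyZ !rootE horner_exp expf_eq0 /=; left.
Qed.

Lemma coprimep_modulus n (b : {poly rat}) : (1 < n)%N ->
  (forall w, (w ^+ 2) ^+ n = 1 -> w ^+ 2 != 1 -> eval_at w b != 0) ->
  coprimep b (polyZ_to_Q (modulus n)).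
Proof.
move=> n1 bP; rewrite coprimep_sym -(coprimep_map (ratr : {rmorphism rat -> algC})).
by apply: Pdiv.ClosedField.root_coprimep => w /root_modulus [] //; apply: bP.
Qed.

(** [Phi_n(X^2)] divides the separable [X^(2n) - 1], so its roots in [algC] are simple and vanishing
    at each of them suffices. *)
Lemma dvdp_cyclotomic_sq n (p : {poly rat}) : (0 < n)%N ->
  (forall w, n.-primitive_root (w ^+ 2) -> eval_at w p = 0) ->
  polyZ_to_Q ('Phi_n \Po 'X^2) %| p.
Proof.
move=> n0 pP; rewrite -(dvdp_map (ratr : {rmorphism rat -> algC})) map_ratr_polyZ.
set D := map_poly intr _.
have sepD : separable_poly D.
  apply: (@dvdp_separable _ ('X^(2 * n) - 1)); last first.
    by apply: separable_Xn_sub_1; rewrite pnatr_eq0 muln_eq0 -lt0n.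
  have -> : 'X^(2 * n) - 1 = map_poly intr (('X^n - 1 : {poly int}) \Po 'X^2) :> {poly algC}.
    by rewrite comp_polyB comp_polyC comp_Xn_poly -exprM rmorphB rmorph1 /= map_polyXn.
  have nn : n \in divisors n by rewrite -dvdn_divisors.
  rewrite -(prod_Cyclotomic n0) (big_rem n nn) /= rmorphM rmorphM /=.
  exact: dvdp_mulr.
have D0 : D != 0 by apply: separable_poly_neq0.
have [r Dr] := closed_field_poly_normal D.
have lD0 : lead_coef D != 0 by rewrite lead_coef_eq0.
rewrite Dr dvdpZl //; apply: uniq_roots_dvdp; last first.
  rewrite uniq_rootsE -separable_prod_XsubC.
  by rewrite -(eqp_separable (eqp_scale _ lD0)) -Dr.
apply/allP => w wr; rewrite rootE -eval_atE; apply/eqP/pP.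
by rewrite -root_cyclotomic_sq // -/D Dr rootZ // root_prod_XsubC.
Qed.

(** [congr_mod] asks for integer coefficients, while divisibility is obtained over [rat];
    denominators are cleared here. *)
Lemma congr_mod_polyQ (F G : RF) (P : {poly int}) (c b : {poly rat}) :
  b != 0 -> coprimep b (polyZ_to_Q P) ->
  F - G = tofrac (polyZ_to_Q P * c) / tofrac b -> congr_mod F G P.
Proof.
move=> b0 cop FG.
have [c' [m m0 cE]] := rat_poly_scale c; have [b' [l l0 bE]] := rat_poly_scale b.
rewrite -/(polyZ_to_Q _) in cE bE.
have mQ : (m%:~R : rat) != 0 by rewrite intr_eq0.
have lQ : (l%:~R : rat) != 0 by rewrite intr_eq0.
have b'E : polyZ_to_Q b' = l%:~R *: b by rewrite bE scalerA divff // scale1r.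
have polyZZ k p : polyZ_to_Q (k *: p) = k%:~R *: polyZ_to_Q p.
  by rewrite /polyZ_to_Q linearZ.
have B : polyZ_to_Q (m *: b') = (m%:~R * l%:~R) *: b.
  by rewrite polyZZ b'E scalerA.
(* As [c = c' / m] and [b = b' / l], these are [m * l] times the rational numerator and
   denominator. *)
exists (P * (l *: c')), (m *: b'); split.
- apply: contra_neq b0 => E; have := B; rewrite E /polyZ_to_Q rmorph0 => /esym/eqP.
  by rewrite scaler_eq0 mulf_eq0 (negPf mQ) (negPf lQ) => /eqP.
- by rewrite B coprimepZl // mulf_neq0.
- by exists (l *: c').
rewrite FG /toRF B.
have -> : polyZ_to_Q (P * (l *: c')) = (m%:~R * l%:~R) *: (polyZ_to_Q P * c).
  rewrite {1}/polyZ_to_Q rmorphM /= -/(polyZ_to_Q _) -/(polyZ_to_Q _) polyZZ cE.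
  by rewrite -!scalerAr !scalerA mulrAC divff // mul1r.
rewrite -!mul_polyC !tofracM -mulf_div divff ?mul1r //.
by rewrite tofrac_eq0 polyC_eq0 mulf_neq0.
Qed.

(** * The certificate at the endpoints and the reduction common to both sums *)

Section Target.
Variable R : comNzRingType.
Implicit Types q : R.

(** Polynomial form of [certificate_den q] times the constant [2q + 2/q - 1] of the congruence; see
    [target_den]. *)
Definition certificate_target (q : R) : R :=
  q ^+ 8 * (1 + q ^+ 2) * (1 - q ^+ 2) ^+ 2 * (2 * q ^+ 2 + 2 - q).

(** For [j = (n+1)/2] and [q^(2n) = 1], the endpoint is [X = q^(2n+6) = q^6]; the factor [q^2] is
    the [u] of [gauss_binom_half_pow4]. *)
Lemma certificate_half q : q ^+ 2 * certificate q (q ^+ 6) = certificate_target q.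
Proof. by rewrite /certificate /certificate_target; ring. Qed.

(** For [j = n-1] and [q^(2n) = 1], the endpoint is [X = q^(4n) = 1]; the factor [q^8] is the fourth
    power of the Catalan value [-q^2]. *)
Lemma certificate_full q : q ^+ 8 * certificate q 1 = certificate_target q.
Proof. by rewrite /certificate /certificate_target; ring. Qed.

End Target.

Section MorphCertificate.
Variables (R S : comNzRingType) (f : {rmorphism R -> S}).

Lemma rmorph_certificate q X : f (certificate q X) = certificate (f q) (f X).
Proof.
by rewrite /certificate !(rmorphB, rmorphD, rmorphM, rmorphXn, rmorph1, rmorph_nat).
Qed.

Lemma rmorph_cert_den q : f (certificate_den q) = certificate_den (f q).
Proof. by rewrite /certificate_den !(rmorphB, rmorphD, rmorphM, rmorphXn, rmorph1). Qed.

Lemma rmorph_target q : f (certificate_target q) = certificate_target (f q).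
Proof.
by rewrite /certificate_target !(rmorphB, rmorphD, rmorphM, rmorphXn, rmorph1, rmorph_nat).
Qed.
End MorphCertificate.

Lemma cert_den_neq0 (F : fieldType) (q : F) :
  q != 0 -> 1 + q ^+ 2 != 0 -> 1 - q ^+ 2 != 0 -> certificate_den q != 0.
Proof. by move=> *; rewrite !mulf_neq0 ?expf_neq0. Qed.

Lemma target_den (F : fieldType) (q : F) : q != 0 ->
  certificate_target q = certificate_den q * (2 * q + 2 * q^-1 - 1).
Proof. by move=> q0; rewrite /certificate_target /certificate_den; field. Qed.

Lemma qint_sq_poly_frac n :
  tofrac (polyZ_to_Q (qint_sq_poly n)) = \sum_(i < n) (qq ^+ 2) ^+ i.
Proof. by rewrite qint_sq_polyQ rmorph_geom rmorphXn. Qed.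

Lemma qint_sqE n : qint (qq ^+ 2) n%:Z = tofrac (polyZ_to_Q (qint_sq_poly n)).
Proof.
rewrite qint_sq_poly_frac /qint -exprnP -[1 - _]opprB subrX1 -mulNr opprB.
by rewrite mulrC mulKf // one_sub_qqX.
Qed.

Lemma combine_fractions (F : fieldType) (N y z c d t k : F) :
  z != 0 -> d != 0 -> t = d * k ->
  (N * y / z) ^+ 4 * c / d - k * N ^+ 4
  = N ^+ 4 * (y ^+ 4 * c - z ^+ 4 * t) / (z ^+ 4 * d).
Proof. by move=> z0 d0 ->; field; rewrite ?z0 ?d0. Qed.

(** The difference of the two sides is exactly [[n]_x^4 Num / (Z^4 certificate_den)]. Nonvanishing
    of [Z] gives a denominator coprime to the modulus, and the last hypothesis makes [Num] vanish at
    every root of [Phi_n(q^2)]. *)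
Lemma congr_mod_sum n j (Y Z : {poly rat}) : (1 < n)%N -> odd n -> Z != 0 ->
  prod_odd (qq ^+ 2) j / prod_even (qq ^+ 2) j
    = tofrac (polyZ_to_Q (qint_sq_poly n)) * tofrac Y / tofrac Z ->
  (forall w, (w ^+ 2) ^+ n = 1 -> w ^+ 2 != 1 -> eval_at w Z != 0) ->
  (forall w, n.-primitive_root (w ^+ 2) ->
    eval_at w Y ^+ 4 * certificate w (w ^+ (4 * j.+1))
    = eval_at w Z ^+ 4 * certificate_target w) ->
  congr_mod (\sum_(0 <= k < j.+1) summand k)
    ((2 * qq + 2 * qq^-1 - 1) * (qint (qq ^+ 2) n%:Z) ^+ 4) (modulus n).
Proof.
move=> n1 n_odd Z0 ratioE Zroot YZ; have n0 := ltnW n1.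
set Num := Y ^+ 4 * certificate 'X 'X^(4 * j.+1) - Z ^+ 4 * certificate_target 'X.
have d0 : certificate_den qq != 0.
  exact: (cert_den_neq0 qq_neq0 (@one_add_qqX 2 isT) (@one_sub_qqX 2 isT)).
have /dvdpP[c NumE] : polyZ_to_Q ('Phi_n \Po 'X^2) %| Num.
  apply: dvdp_cyclotomic_sq => // w wP.
  rewrite /Num rmorphB (rmorphM _ (Y ^+ 4)) (rmorphM _ (Z ^+ 4)) rmorph_target.
  rewrite rmorph_certificate !rmorphXn eval_atX.
  by rewrite YZ // subrr.
apply: (@congr_mod_polyQ _ _ _ c (Z ^+ 4 * certificate_den 'X)).
- rewrite mulf_neq0 ?expf_neq0 // -tofrac_eq0 rmorph_cert_den; exact: d0.
- apply: coprimep_modulus => // w wn w1.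
  rewrite rmorphM rmorphXn rmorph_cert_den eval_atX mulf_neq0 ?expf_neq0 ?Zroot //.
  have w0 : w != 0.
    by apply: contra_eq_neq wn => ->; rewrite expr0n expr0n eqn0Ngt n0 eq_sym oner_eq0.
  rewrite cert_den_neq0 // ?subr_eq0 1?[1 == _]eq_sym //.
  have := @root_of_unity_add1_neq0 _ _ _ n_odd wn _ 1; rewrite expr1; apply.
  by rewrite pnatr_eq0.
rewrite sum_summand ratioE qint_sqE.
rewrite (combine_fractions _ _ _ _ d0 (target_den qq_neq0)) ?tofrac_eq0 //.
have -> : polyZ_to_Q (modulus n) * c = polyZ_to_Q (qint_sq_poly n) ^+ 4 * Num.
  by rewrite NumE {1}/polyZ_to_Q /modulus rmorphM rmorphXn /= -!mulrA [c * _]mulrC.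
by rewrite !(rmorph_certificate, rmorph_target, rmorph_cert_den, rmorphB, rmorphM, rmorphXn).
Qed.

(** * The two truncations of the sum *)

Lemma prod_ratio k : prod_odd (qq ^+ 2) k / prod_even (qq ^+ 2) k
  = gauss_binom (qq ^+ 2) k k / prod_plus (qq ^+ 2) k ^+ 2.
Proof.
have A0 := prod_all_qq_neq0 k; have P0 := prod_plus_qq_neq0 k.
have /(mulfI (mulf_neq0 (expf_neq0 2 A0) P0)) E := prod_odd_gauss (qq ^+ 2) k.
by apply/eqP; rewrite eqr_div ?prod_even_qq_neq0 ?expf_neq0 //; apply/eqP.
Qed.

Lemma congr_mod_half_sum n : (1 < n)%N -> odd n ->
  congr_mod (\sum_(0 <= k < ((n + 1) %/ 2).+1) summand k)
    ((2 * qq + 2 * qq^-1 - 1) * (qint (qq ^+ 2) n%:Z) ^+ 4) (modulus n).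
Proof.
move=> n1 n_odd; have En : n = (n./2).*2.+1 by rewrite -[LHS]odd_double_half n_odd.
have -> : ((n + 1) %/ 2)%N = (n./2).+1 by lia.
(* The last ratio factor [(1 - x^n) / (1 - x^(n+1))] is [[n]_x / [n+1]_x]; the geometric sum in [Z]
   is [[n+1]_x], which equals 1 at the roots of the modulus. *)
pose Z : {poly rat} := prod_plus ('X ^+ 2) n./2 ^+ 2 * \sum_(i < n.+1) ('X ^+ 2) ^+ i.
have ZE : tofrac Z = prod_plus (qq ^+ 2) n./2 ^+ 2 * \sum_(i < n.+1) (qq ^+ 2) ^+ i.
  by rewrite rmorphM rmorphXn rmorph_prod_plus rmorph_geom !rmorphXn.
have geomE k : 1 - (qq ^+ 2) ^+ k = (1 - qq ^+ 2) * \sum_(i < k) (qq ^+ 2) ^+ i.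
  by rewrite -[LHS]opprB subrX1 -mulNr opprB.
have x1 := one_sub_qqX (isT : 0 < 2)%N.
have G0 : \sum_(i < n.+1) (qq ^+ 2) ^+ i != 0.
  have := one_sub_qqX (isT : 0 < 2 * n.+1)%N.
  by rewrite exprM geomE mulf_eq0 negb_or => /andP[].
have Z0 : tofrac Z != 0.
  by rewrite ZE mulf_neq0 ?expf_neq0 ?prod_plus_qq_neq0.
have evZ w : eval_at w Z =
    prod_plus (w ^+ 2) n./2 ^+ 2 * \sum_(i < n.+1) (w ^+ 2) ^+ i.
  by rewrite rmorphM rmorphXn rmorph_prod_plus rmorph_geom rmorphXn eval_atX.
apply: (@congr_mod_sum _ _ (gauss_binom ('X ^+ 2) n./2 n./2) Z) => //.
- by rewrite -tofrac_eq0.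
- rewrite prod_oddS prod_evenS -mulf_div prod_ratio.
  have -> : (2 * n./2).+1 = n by lia.
  rewrite !geomE -mulf_div divff // mul1r ZE qint_sq_poly_frac rmorph_gauss_binom rmorphXn.
  rewrite mulf_div. by rewrite [X in X / _]mulrC.
- move=> w wn w1; rewrite evZ (geom_root_of_unityS wn w1) mulr1 expf_neq0 //.
  by apply: (prod_plus_neq0 n_odd wn); rewrite pnatr_eq0.
move=> w wP; have wn := prim_expr_order wP.
have w1 : w ^+ 2 != 1 by rewrite -[X in X != 1]expr1 -(prim_order_dvd wP) gtnNdvd.
rewrite evZ (geom_root_of_unityS wn w1) mulr1 rmorph_gauss_binom rmorphXn eval_atX.
rewrite (gauss_binom_half_pow4 n_odd wP) mulrAC -certificate_half.
have -> : w ^+ (4 * (n./2).+2) = w ^+ 6.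
  have -> : (4 * (n./2).+2 = 2 * n + 6)%N by lia.
  by rewrite exprD exprM wn mul1r.
by rewrite mulrC.
Qed.

Lemma congr_mod_full_sum n : (1 < n)%N -> odd n ->
  congr_mod (\sum_(0 <= k < n) summand k)
    ((2 * qq + 2 * qq^-1 - 1) * (qint (qq ^+ 2) n%:Z) ^+ 4) (modulus n).
Proof.
case: n => [|[|n]] // n1 n_odd; set N := n.+2 in n1 n_odd *.
pose Z : {poly rat} := prod_plus ('X ^+ 2) n.+1 ^+ 2.
(* The cofactor of [[N]_x] in the central binomial, by [gauss_binom_catalan]; here [N] is the
   original [n]. *)
pose Y : {poly rat} := gauss_binom ('X ^+ 2) n.+1 n.+1 - 'X ^+ 2 * gauss_binom ('X ^+ 2) N n.
have ZE : tofrac Z = prod_plus (qq ^+ 2) n.+1 ^+ 2.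
  by rewrite rmorphXn rmorph_prod_plus rmorphXn.
have evZ w : eval_at w Z = prod_plus (w ^+ 2) n.+1 ^+ 2.
  by rewrite rmorphXn rmorph_prod_plus rmorphXn eval_atX.
apply: (@congr_mod_sum _ _ Y Z) => //.
- by rewrite -tofrac_eq0 ZE expf_neq0 ?prod_plus_qq_neq0.
- rewrite prod_ratio ZE; congr (_ / _).
  rewrite rmorphB rmorphM !rmorph_gauss_binom !rmorphXn qint_sq_poly_frac -/qq.
  by apply: gauss_binom_catalan => k; apply: prod_all_qq_neq0.
- move=> w wn w1; rewrite evZ expf_neq0 //.
  by apply: (prod_plus_neq0 n_odd wn); rewrite pnatr_eq0.
move=> w wP; have wn := prim_expr_order wP.
rewrite evZ (prod_plus_order n_odd wP) !expr1n mul1r.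
(* The central binomial vanishes because [2(n+1) >= N], and the neighbouring one is 1 by
   [gauss_binom_order]. *)
have -> : eval_at w Y = - w ^+ 2.
  rewrite rmorphB rmorphM !rmorph_gauss_binom !rmorphXn eval_atX.
  rewrite (gauss_binom_order wP) // (gauss_binom_eq0 wP) ?sub0r ?mulr1 //.
  by rewrite /N; lia.
have -> : w ^+ (4 * N) = 1.
  by rewrite (_ : 4 * N = 2 * N * 2)%N; [rewrite exprM exprM wn expr1n | lia].
by rewrite -certificate_full; congr (_ * _); ring.
Qed.

Theorem theorem1 (n : nat) (hn : (1 < n)%N) (hodd : odd n) :
  congr_mod (\sum_(0 <= k < ((n + 1) %/ 2).+1) summand k)
            ((2 * qq + 2 * qq^-1 - 1) * (qint (qq ^+ 2) n%:Z) ^+ 4)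
            (modulus n)
  /\
  congr_mod (\sum_(0 <= k < n) summand k)
            ((2 * qq + 2 * qq^-1 - 1) * (qint (qq ^+ 2) n%:Z) ^+ 4)
            (modulus n).
Proof. by split; [apply: congr_mod_half_sum | apply: congr_mod_full_sum]. Qed.
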